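(* For every integer $n \ge 2$ and every pair of distinct edges $e \ne f$ of $K_n$, $$\mathbf{P}(e \in F_n \text{ and } f \in F_n) \;\le\; \mathbf{P}(e \in F_n)\,\mathbf{P}(f \in F_n),$$ where $F_n$ is a uniformly random forest of $K_n$.
   Context: $K_n$ is the simple complete graph on the vertex set $[n]=\{1,\dots,n\}$. A forest of $K_n$ is an acyclic subset of the edge set of $K_n$ (isolated vertices are permitted, the empty set is included, and there is no connectivity or spanning requirement). $F_n$ is chosen uniformly at random from the set of all forests of $K_n$. For $n=2$ there is only one edge, so the statement is vacuous. *)

(* Defs.v *)
From HB Require Import structures.
From mathcomp Require Import all_boot all_order all_algebra.

Set Implicit Arguments.
Unset Strict Implicit.
Unset Printing Implicit Defensive.

Import Order.TTheory GRing.Theory Num.Theory.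
Local Open Scope ring_scope.

(* The vertex set [n] = {1, ..., n} is encoded as 'I_n. *)
Definition complete_edges (n : nat) : {set {set 'I_n}} :=
  [set e : {set 'I_n} | #|e| == 2%N].

Definition adj (n : nat) (F : {set {set 'I_n}}) : rel 'I_n :=
  fun x y => [set x; y] \in F.

(* A graph cycle is a cyclic sequence of at least 3 distinct vertices with
   consecutive ones adjacent.  Such a sequence has length at most n, so letting
   k range over 'I_n.+1 loses nothing (see acyclicP). *)
Definition acyclic (n : nat) (F : {set {set 'I_n}}) : bool :=
  [forall k : 'I_n.+1, [forall c : k.-tuple 'I_n,
     (3 <= k)%N ==> ~~ ucycleb (adj F) c]].

Lemma acyclicP (n : nat) (F : {set {set 'I_n}}) :
  reflect (forall c : seq 'I_n, (3 <= size c)%N -> ~ ucycle (adj F) c)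
          (acyclic F).
Proof.
apply: (iffP forallP) => [H c c3 /andP[cc uc]|H k].
  have ltc : (size c < n.+1)%N.
    by rewrite ltnS -[leqRHS](card_ord n) -(card_uniqP uc) max_card.
  have /forallP/(_ (in_tuple c))/implyP/(_ c3) := H (Ordinal ltc).
  by rewrite /ucycleb /= cc uc.
apply/forallP => c; apply/implyP => k3; apply/negP => cc.
by apply: (H c) => //; rewrite size_tuple.
Qed.

Definition forests (n : nat) : {set {set {set 'I_n}}} :=
  [set F : {set {set 'I_n}} | (F \subset complete_edges n) && acyclic F].

Definition forest_prob (n : nat) (A : pred {set {set 'I_n}}) : rat :=
  #|[set F in forests n | A F]|%:R / #|forests n|%:R.

(* Main.v *)
Require Import Defs.
From mathcomp Require Import all_boot all_order all_algebra.
From mathcomp Require Import ring lra zify.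

Set Implicit Arguments.
Unset Strict Implicit.
Unset Printing Implicit Defensive.

Import Order.TTheory GRing.Theory Num.Theory.
Local Open Scope ring_scope.

(** Every quantity in the inequality is a value of one two-parameter count.  If
    S is a set of w vertices among k + w, let G(k, w) be the number of forests
    on these vertices whose components contain at most one vertex of S each.
    Such a forest stays acyclic when a tree on S is added to it, so G(n - 2, 2)
    counts the forests of K_n through a given edge, and G(n - 3, 3) those
    through two given adjacent edges ([nforests_contract]).

    Deleting a root s of S makes the neighbours of s new roots, whence
      G(k, w + 1) = sum_j C(k, j) G(k - j, w + j)
    ([nforests_peel]), while G(k + 1, 0) = G(k, 1) because one root separates
    nothing.  The sum k - j + w + j does not depend on j, so with the
    polynomials He_k of generating function exp(y t - t^2/2), for which shifting
    y by 1 is a binomial sum, the recursion is solved by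
      G(k, w) = He_k(y) - k He_(k-1)(y),  y = k + w + 1
    ([nforests_rooted_count]).  The same peeling counts the forests that contain
    a prescribed edge disjoint from S: they number
    (1 + 2 w) He_k(y) - k He_(k-1)(y) with y = k + w + 3, where k is the number
    of remaining vertices ([nforests_rooted_edge_count]); for w = 2 these are the
    forests through two disjoint edges.

    For K_n all these values have the same argument y = n + 1.  With M = n - 3,
    a = He_M(n + 1) and b = He_(M-1)(n + 1), the three-term recurrence turns the
    numbers of forests, of forests through an edge, through two adjacent edges
    and through two disjoint edges into
      (M + 7) a - 2 M b,   3 a - M b,   a - M b,   a - (M - 1) b.
    The adjacent case therefore follows from the disjoint one, which is a
    quadratic inequality in s = a/b - M.  At s = 3 + 4/M the two sides agree in
    their two leading orders in M, so a precise upper bound on a/b is needed; two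
    steps of the continued fraction a/b = y - (M - 1)/(y - (M - 2)/...) give one
    ([hermite_ratio_le], [quadratic_bound]). *)

(** * Adding an edge to a graph *)

Lemma adj_sym (n : nat) (F : {set {set 'I_n}}) : symmetric (adj F).
Proof. by move=> x y; rewrite /adj setUC. Qed.

Lemma adj_connect_sym (n : nat) (F : {set {set 'I_n}}) : connect_sym (adj F).
Proof. exact: sym_connect_sym (adj_sym F). Qed.

Lemma sub_adj (n : nat) (F G : {set {set 'I_n}}) :
  F \subset G -> subrel (adj F) (adj G).
Proof. by move=> /subsetP sFG x y /sFG. Qed.

Lemma sub_connect_adj (n : nat) (F G : {set {set 'I_n}}) (x y : 'I_n) :
  F \subset G -> connect (adj F) x y -> connect (adj G) x y.
Proof.
move=> sFG; apply: connect_sub x y => x y Fxy.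
exact/connect1/(sub_adj sFG).
Qed.

Lemma acyclicS (n : nat) (F G : {set {set 'I_n}}) :
  F \subset G -> acyclic G -> acyclic F.
Proof.
move=> sFG /acyclicP acG; apply/acyclicP => c c3 /andP[cc uc].
by apply: (acG c c3); rewrite /ucycle (sub_cycle (sub_adj sFG) cc).
Qed.

Lemma eq_set2 (n : nat) (x y p q : 'I_n) :
  [set x; y] = [set p; q] -> (x = p /\ y = q) \/ (x = q /\ y = p).
Proof.
move=> E.
have : x \in [set p; q] by rewrite -E set21.
have : y \in [set p; q] by rewrite -E set22.
have : p \in [set x; y] by rewrite E set21.
have : q \in [set x; y] by rewrite E set22.
by do 4![case/set2P=> ?]; subst; auto.
Qed.

Lemma adjU1 (n : nat) (F : {set {set 'I_n}}) (p q x y : 'I_n) :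
  adj ([set p; q] |: F) x y -> x != p -> y != p -> adj F x y.
Proof.
rewrite /adj in_setU1 => /orP[/eqP/eq_set2|//].
by case=> -[-> ->]; rewrite eqxx.
Qed.

Lemma pathU1 (n : nat) (F : {set {set 'I_n}}) (p q x : 'I_n) (c : seq 'I_n) :
  path (adj ([set p; q] |: F)) x c -> p \notin x :: c -> path (adj F) x c.
Proof.
elim: c x => //= y c IHc x /andP[xy yc].
rewrite !inE !negb_or => /and3P[px py pc].
by rewrite (adjU1 xy) 1?eq_sym //= IHc // inE negb_or py.
Qed.

Lemma connectU1 (n : nat) (F : {set {set 'I_n}}) (p q x y : 'I_n) :
  connect (adj ([set p; q] |: F)) x y ->
  [\/ connect (adj F) x y,
      connect (adj F) x p /\ connect (adj F) q y |
      connect (adj F) x q /\ connect (adj F) p y].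
Proof.
case/connectP=> c; elim: c x => [|z c IHc] x /=.
  by move=> _ ->; constructor 1.
case/andP=> xz zc ly; move: xz (IHc z zc ly).
rewrite /adj in_setU1 => /orP[/eqP/eq_set2[[-> ->]|[-> ->]]|xz].
- case=> [qy|[_ qy]|[_ py]]; [constructor 2|constructor 2|constructor 1] => //.
- case=> [py|[_ qy]|[_ py]]; [constructor 3|constructor 1|constructor 3] => //.
have cxz : connect (adj F) x z by apply: connect1.
case=> [zy|[zp qy]|[zq py]]; [constructor 1|constructor 2|constructor 3].
- exact: connect_trans zy.
- by split=> //; exact: connect_trans zp.
- by split=> //; exact: connect_trans zq.
Qed.

(** A path from p to q in F closes up with the new edge; conversely a cycle
    through the new edge leaves such a path when that edge is removed. *)
Lemma acyclicU1 (n : nat) (F : {set {set 'I_n}}) (p q : 'I_n) :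
  p != q -> [set p; q] \notin F ->
  acyclic ([set p; q] |: F) = acyclic F && ~~ connect (adj F) p q.
Proof.
move=> pq nF; apply/idP/andP => [ac|[/acyclicP acF npq]].
  split; first exact: acyclicS (subsetUr _ _) ac.
  apply/negP => /connectP[c0 pc0 lc0].
  case/shortenP: pc0 lc0 => c pc uc _ lc.
  case: c pc uc lc => [|y [|z c]] pc uc lc.
  - by rewrite lc eqxx in pq.
  - by move: pc nF; rewrite /= andbT /adj lc => ->.
  move/acyclicP: ac => /(_ [:: p, y, z & c] isT) []; rewrite /ucycle uc andbT.
  rewrite (cycle_path p) /= -[last z c]/(last p [:: y, z & c]) -lc.
  rewrite {1}/adj setUC setU11 /=.
  by apply: sub_path pc; apply/sub_adj/subsetUr.
(* A cycle that avoids p lies in F; otherwise it is rotated to start at p, so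
   that only its first and last edges can be the new one. *)
apply/acyclicP => c c3 /andP[cc uc]; case: (boolP (p \in c)) => [pc|pc]; last first.
  apply: (acF c c3); rewrite /ucycle uc andbT.
  case: c cc pc {c3 uc} => //= x c xc pxc; apply: pathU1 xc _.
  by move: pxc; rewrite !inE mem_rcons inE; case: (p == x).
case: (rot_to pc) => i c' rc.
have size_c' : (3 <= size (p :: c'))%N by rewrite -rc size_rot.
have {}cc : cycle (adj ([set p; q] |: F)) (p :: c') by rewrite -rc rot_cycle.
have {uc} : uniq (p :: c') by rewrite -rc rot_uniq.
case: c' size_c' {rc} cc => [|y c'] // size_c'.
rewrite /= rcons_path => /and3P[py yc zp] /and3P[npc nyc uc].
have pz : last y c' != p by apply: contraNneq npc => <-; exact: mem_last.
have yz : last y c' != y.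
  case: c' size_c' nyc {yc zp npc uc pz} => [|t c'] // _ nyc.
  by apply: contraNneq nyc => {1}<- /=; exact: mem_last.
have {}yc : path (adj F) y c' by apply: pathU1 yc npc.
have cyz : connect (adj F) y (last y c') by apply/connectP; exists c'.
have edgeF u : adj ([set p; q] |: F) p u -> u != q -> adj F p u.
  rewrite /adj in_setU1 => /orP[/eqP/eq_set2|//].
  by case=> -[e1 ->]; rewrite ?eqxx // -e1 => /eqP.
have {zp} pz' : adj ([set p; q] |: F) p (last y c') by rewrite adj_sym.
have [yq|yq] := eqVneq y q.
  case/negP: npq; rewrite adj_connect_sym -yq.
  apply: connect_trans cyz _; rewrite adj_connect_sym; apply: connect1.
  by apply: edgeF; rewrite // -yq.
have [zq|zq] := eqVneq (last y c') q.
  by case/negP: npq; rewrite -zq; apply: connect_trans cyz; apply/connect1/edgeF.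
apply: (acF (p :: y :: c')) => //.
rewrite /ucycle /= npc nyc uc rcons_path yc !andbT /= edgeF //=.
by rewrite adj_sym edgeF.
Qed.

(** * Forests with separated roots *)

Definition separated (n : nat) (F : {set {set 'I_n}}) (S : {set 'I_n}) : bool :=
  [forall x in S, forall y in S, connect (adj F) x y ==> (x == y)].

Lemma separatedP (n : nat) (F : {set {set 'I_n}}) (S : {set 'I_n}) :
  reflect {in S &, forall x y, connect (adj F) x y -> x = y} (separated F S).
Proof.
apply: (iffP forall_inP) => [sepS x y Sx Sy cxy | sepS x Sx].
  by move/forall_inP/(_ y Sy)/implyP/(_ cxy): (sepS x Sx) => /eqP.
by apply/forall_inP => y Sy; apply/implyP => /(sepS _ _ Sx Sy)/eqP.
Qed.

Lemma separatedS (n : nat) (F G : {set {set 'I_n}}) (A B : {set 'I_n}) :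
  F \subset G -> A \subset B -> separated G B -> separated F A.
Proof.
move=> sFG /subsetP sAB /separatedP sepG; apply/separatedP => x y Ax Ay cxy.
exact: sepG (sAB _ Ax) (sAB _ Ay) (sub_connect_adj sFG cxy).
Qed.

Lemma separated_le1 (n : nat) (F : {set {set 'I_n}}) (S : {set 'I_n}) :
  (#|S| <= 1)%N -> separated F S.
Proof. by move=> /card_le1_eqP S1; apply/separatedP => x y Sx Sy _; exact: S1. Qed.

Definition separating_forest (n : nat) (F : {set {set 'I_n}}) (S : {set 'I_n}) :=
  acyclic F && separated F S.

(** The new edge joins the component of q to that of the root p; this creates
    neither a cycle nor a connection between roots exactly when q was connected
    to no root, that is, when q could serve as an additional root. *)
Lemma separating_forestU1 (n : nat) (F : {set {set 'I_n}}) (S : {set 'I_n})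
    (p q : 'I_n) :
  p \in S -> q \notin S -> [set p; q] \notin F ->
  separating_forest ([set p; q] |: F) S = separating_forest F (q |: S).
Proof.
move=> pS qS nF; have pq : p != q by apply: contraNneq qS => <-.
rewrite /separating_forest acyclicU1 // -andbA; congr (_ && _).
apply/andP/idP => [[npq /separatedP sepS]|sepS].
  have q_sep x : x \in S -> ~~ connect (adj F) x q.
    move=> Sx; apply: contra npq => xq.
    rewrite -(sepS _ _ Sx pS) //; apply: (@connect_trans _ _ q).
      exact: sub_connect_adj (subsetUr _ _) xq.
    by apply: connect1; rewrite /adj setUC setU11.
  apply/separatedP => x y; rewrite !inE.
  case/predU1P=> [->|Sx] /predU1P[->|Sy] // cxy.
  - by case/negP: (q_sep y Sy); rewrite adj_connect_sym.
  - by case/negP: (q_sep x Sx).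
  - exact/sepS/(sub_connect_adj (subsetUr _ _)).
move/separatedP: sepS => sepS; have qq : q \in q |: S by rewrite setU11.
have SqS x : x \in S -> x \in q |: S by rewrite inE orbC => ->.
split.
  by apply/negP => /(sepS _ _ (SqS _ pS) qq) /eqP; rewrite (negPf pq).
apply/separatedP => x y Sx Sy /connectU1[|[_ qy]|[xq _]].
- by apply: sepS; apply: SqS.
- by case/negP: qS; rewrite (sepS _ _ qq (SqS _ Sy) qy).
- by case/negP: qS; rewrite -(sepS _ _ (SqS _ Sx) qq xq).
Qed.

Definition star (n : nat) (s : 'I_n) (R : {set 'I_n}) : {set {set 'I_n}} :=
  [set [set s; r] | r in R].

Lemma mem_star (n : nat) (s r : 'I_n) (R : {set 'I_n}) :
  s \notin R -> ([set s; r] \in star s R) = (r \in R).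
Proof.
move=> sR; apply/imsetP/idP => [[r' Rr' /eq_set2[[_ ->//]|[E _]]]|Rr].
  by rewrite E Rr' in sR.
by exists r.
Qed.

Lemma starU1 (n : nat) (s r : 'I_n) (R : {set 'I_n}) :
  star s (r |: R) = [set s; r] |: star s R.
Proof. by rewrite /star imsetU1. Qed.

(** Edges are added to F one at a time, each by [separating_forestU1].  As s is
    isolated in F, all of R can be attached to it. *)
Lemma separating_forest_star (n : nat) (F : {set {set 'I_n}}) (S R : {set 'I_n})
    (s : 'I_n) :
  s \in S -> [disjoint R & S] -> (forall r, [set s; r] \notin F) ->
  separating_forest (star s R :|: F) S = separating_forest F (R :|: S).
Proof.
elim: {R}_.+1 {-2}R (ltnSn #|R|) S => // m IHm R ltRm S sS dRS sF.
have [->|[r Rr]] := set_0Vmem R; first by rewrite /star imset0 !set0U.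
have nS x : x \in R -> x \notin S by move=> Rx; rewrite (disjointFr dRS Rx).
have sR : s \notin R by apply/negP => /nS; rewrite sS.
rewrite -(setD1K Rr) starU1 -(setUA [set [set s; r]]) separating_forestU1 ?nS //; last first.
  rewrite inE (negPf (sF r)) orbF mem_star; last by rewrite !inE (negPf sR) andbF.
  by rewrite !inE eqxx.
rewrite IHm ?inE ?sS ?orbT //; first by rewrite setUCA setUA.
- by move: ltRm; rewrite (cardsD1 r) Rr.
- rewrite -setI_eq0; apply/eqP/setP => x; rewrite !inE.
  case: eqP => //= _; apply/negbTE/andP => -[Rx Sx].
  by case/negP: (nS x Rx).
Qed.

Lemma separating_forestD1 (n : nat) (F : {set {set 'I_n}}) (S : {set 'I_n})
    (s : 'I_n) :
  (forall r, [set s; r] \notin F) ->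
  separating_forest F S = separating_forest F (S :\ s).
Proof.
move=> sF; congr (_ && _); apply/idP/idP; first exact: separatedS (subD1set _ _).
move=> /separatedP sepS.
have iso x y : connect (adj F) x y -> x = s -> x = y.
  case/connectP=> -[|z c] /= => [_ ->//|/andP[xz _] _ xs].
  by rewrite xs /adj (negPf (sF z)) in xz.
apply/separatedP => x y Sx Sy cxy.
have [xs|xs] := eqVneq x s; first exact: iso xs.
have [ys|ys] := eqVneq y s; first by apply/esym/iso; rewrite // adj_connect_sym.
by apply: sepS; rewrite // !inE ?xs ?ys.
Qed.

Definition edges_in (n : nat) (U : {set 'I_n}) : {set {set 'I_n}} :=
  [set e in complete_edges n | e \subset U].

(** E is a set of prescribed edges.  The vertices outside U have been deleted:
    no edge of F touches them. *)
Definition nforests (n : nat) (U S : {set 'I_n}) (E : {set {set 'I_n}}) : nat :=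
  #|[set F : {set {set 'I_n}} |
     [&& F \subset edges_in U, E \subset F & separating_forest F S]]|.

Lemma set2_edges_in (n : nat) (U : {set 'I_n}) (x y : 'I_n) :
  ([set x; y] \in edges_in U) = [&& x != y, x \in U & y \in U].
Proof.
by rewrite !inE cards2 subUset !sub1set; case: (x != y).
Qed.

(** Contraction of the edge pq without a quotient graph: merging q with the root
    p amounts to forbidding any connection between q and the roots. *)
Lemma nforests_contract (n : nat) (U S : {set 'I_n}) (E : {set {set 'I_n}})
    (p q : 'I_n) :
  S \subset U -> q \in U -> p \in S -> q \notin S -> [set p; q] \notin E ->
  nforests U S ([set p; q] |: E) = nforests U (q |: S) E.
Proof.
move=> sSU Uq Sp Sq nE; have pq : p != q by apply: contraNneq Sq => <-.
rewrite /nforests -!sum1dep_card.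
rewrite (reindex_onto (fun F => [set p; q] |: F) (fun F => F :\ [set p; q])).
  (* If F already contains pq it is not of the form F' :\ [set p; q], and q is
     not separated from p in it. *)
  apply: eq_bigl => F; have [pqF|pqF] := boolP ([set p; q] \in F).
    have -> : separating_forest F (q |: S) = false.
      apply/negP => /andP[_ /separatedP sepS].
      by case/eqP: pq; apply: sepS; rewrite ?inE ?eqxx ?Sp ?orbT //; apply: connect1.
    rewrite !andbF; apply/negP => /andP[_ /eqP/setP/(_ [set p; q])].
    by rewrite pqF !inE eqxx.
  rewrite setU1K // eqxx andbT separating_forestU1 // !subUset !sub1set.
  rewrite set2_edges_in pq Uq (subsetP sSU _ Sp) setU11 /=.
  congr [&& _, _ & _]; apply/idP/idP => /subsetP sEF; apply/subsetP => e Ee.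
    by have := sEF e Ee; rewrite in_setU1 => /predU1P[eE|//]; rewrite -eE Ee in nE.
  by rewrite inE sEF ?orbT.
move=> F /and3P[_ + _]; rewrite subUset sub1set => /andP[pqF _].
exact: setD1K.
Qed.

(** A root s is deleted; R is the set of its neighbours.  R avoids S because the
    roots are separated, and the vertices of R become roots because s connects
    them. *)
Lemma nforests_peel (n : nat) (U S : {set 'I_n}) (E : {set {set 'I_n}}) (s : 'I_n) :
  s \in S -> S \subset U -> E \subset edges_in (U :\ s) ->
  nforests U S E =
  (\sum_(R : {set 'I_n} | R \subset U :\: S) nforests (U :\ s) (R :|: S :\ s) E)%N.
Proof.
move=> sS sSU sE; have Us : s \in U by apply: subsetP sSU _ sS.
rewrite {1}/nforests -sum1dep_card.
pose nbr (F : {set {set 'I_n}}) := [set r | [set s; r] \in F].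
rewrite (partition_big nbr (fun R => R \subset U :\: S)) => [|F]; last first.
  case/and3P=> /subsetP sFU _ /andP[_ /separatedP sepS].
  apply/subsetP => r; rewrite !inE => srF.
  have := sFU _ srF; rewrite set2_edges_in => /and3P[sr _ Ur].
  rewrite Ur andbT; apply: contra sr => Sr; apply/eqP/sepS => //.
  exact: connect1.
apply: eq_bigr => R /subsetP sR.
have UR r : r \in R -> r \in U by move/sR; rewrite inE => /andP[].
have nSR r : r \in R -> r \notin S by move/sR; rewrite inE => /andP[].
have sNR : s \notin R by apply/negP => /nSR; rewrite sS.
rewrite /nforests -sum1dep_card.
have star_sub : star s R \subset edges_in U.
  apply/subsetP => _ /imsetP[r Rr ->]; rewrite set2_edges_in Us UR // !andbT.
  by apply: contraNneq sNR => ->.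
have noS (F : {set {set 'I_n}}) r : F \subset edges_in (U :\ s) -> [set s; r] \notin F.
  by move=> /subsetP sF; apply/negP => /sF; rewrite set2_edges_in !inE eqxx andbF.
have edge_s e : e \in edges_in U -> e \notin edges_in (U :\ s) ->
    exists r, e = [set s; r].
  rewrite !inE => /andP[e2 eU]; rewrite e2 /= subsetD1 eU /= negbK => es.
  by case/cards2P: e2 es => x [y [_ ->]] /set2P[->|->]; [exists y|exists x; rewrite setUC].
(* A forest with neighbourhood R at s is its star at s and the rest. *)
rewrite (reindex_onto (fun F => star s R :|: F) (fun F => F :&: edges_in (U :\ s)));
  last first.
  move=> F /andP[/and3P[/subsetP sFU _ _] /eqP nF].
  apply/setP => e; rewrite in_setU in_setI.
  apply/orP/idP => [[/imsetP[r + ->]|/andP[]//]|Fe]; first by rewrite -nF inE.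
  have [Ue|nUe] := boolP (e \in edges_in (U :\ s)); [by right; rewrite Fe|left].
  case: (edge_s e (sFU e Fe) nUe) => r er.
  by rewrite er mem_star // -nF inE -er.
apply: eq_bigl => F.
have [sF|nsF] := boolP (F \subset edges_in (U :\ s)); last first.
  apply/negP => /andP[_ /eqP FE]; case/negP: nsF; rewrite -FE; exact: subsetIr.
have sFU : F \subset edges_in U.
  apply: subset_trans sF _; apply/subsetP => e; rewrite !inE => /andP[-> /=].
  by move/subset_trans; apply; exact: subD1set.
have star_out : star s R :&: edges_in (U :\ s) = set0.
  apply/setP => e; rewrite in_setI in_set0; apply/negbTE/andP => -[/imsetP[r _ ->]].
  by rewrite set2_edges_in !inE eqxx andbF.
rewrite setIUl star_out set0U (setIidPl sF) eqxx andbT subUset star_sub sFU /=.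
have -> : nbr (star s R :|: F) = R.
  by apply/setP => r; rewrite !inE mem_star // (negPf (noS _ _ sF)) orbF.
rewrite eqxx andbT separating_forest_star //; last by move=> r; exact: noS.
  rewrite [in RHS](@separating_forestD1 n F _ s) => [|r]; last exact: noS.
  rewrite (@separating_forestD1 n F (R :|: S) s) => [|r]; last exact: noS.
  have -> : (R :|: S) :\ s = (R :|: S :\ s) :\ s by rewrite !setDUl setDDl setUid.
  congr (_ && _); apply/idP/idP => [/subsetP sEF|sEF]; last first.
    by apply: subset_trans sEF _; exact: subsetUr.
  apply/subsetP => e Ee; have := sEF e Ee; rewrite inE => /orP[se|//].
  have : e \in star s R :&: edges_in (U :\ s) by rewrite inE se (subsetP sE).
  by rewrite star_out inE.
by rewrite -setI_eq0; apply/eqP/setP => x; rewrite !inE; apply/negbTE/andP => -[/nSR/negP].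
Qed.

(** * Hermite polynomials and binomial sums *)

(** The probabilists' Hermite polynomials He_k, with He_k(y)/k! the coefficient of
    t^k in exp(y t - t^2/2).  The inner match only makes the two-step recursion
    structural; [hermiteS] is the recurrence. *)

Fixpoint hermite (k : nat) (y : rat) : rat :=
  match k with
  | 0 => 1
  | k1.+1 => match k1 with
             | 0 => y
             | k2.+1 => y * hermite k1 y - k1%:R * hermite k2 y
             end
  end.

Arguments hermite : simpl never.

Lemma hermiteS (k : nat) (y : rat) :
  hermite k.+1 y = y * hermite k y - k%:R * hermite k.-1 y.
Proof. by case: k => [|k] //; rewrite /hermite /= mulr1 mul0r subr0. Qed.

Definition binsum (k : nat) (phi : nat -> rat) : rat :=
  \sum_(j < k.+1) 'C(k, j)%:R * phi j.

Lemma eq_binsum (k : nat) (phi psi : nat -> rat) :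
  (forall j, (j <= k)%N -> phi j = psi j) -> binsum k phi = binsum k psi.
Proof. by move=> E; apply: eq_bigr => j _; rewrite E // -ltnS. Qed.

Lemma binsumD (k : nat) (phi psi : nat -> rat) :
  binsum k (fun j => phi j + psi j) = binsum k phi + binsum k psi.
Proof. by rewrite -big_split; apply: eq_bigr => j _; rewrite mulrDr. Qed.

Lemma binsumZ (k : nat) (a : rat) (phi : nat -> rat) :
  binsum k (fun j => a * phi j) = a * binsum k phi.
Proof. by rewrite mulr_sumr; apply: eq_bigr => j _; rewrite mulrCA. Qed.

Lemma binsumS (k : nat) (phi : nat -> rat) :
  binsum k.+1 phi = binsum k phi + binsum k (fun j => phi j.+1).
Proof.
rewrite /binsum big_ord_recl bin0 [in LHS](eq_bigr (fun j : 'I_k.+1 =>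
  'C(k, j.+1)%:R * phi j.+1 + 'C(k, j)%:R * phi j.+1)); last first.
  by move=> j _; rewrite lift0 binS natrD mulrDl.
rewrite big_split /= addrA; congr (_ + _).
by rewrite big_ord_recr /= bin_small // mul0r addr0 big_ord_recl /= bin0.
Qed.

Lemma binsum_mull (k : nat) (phi : nat -> rat) :
  binsum k (fun j => j%:R * phi j) = k%:R * binsum k.-1 (fun j => phi j.+1).
Proof.
case: k => [|k]; first by rewrite /binsum big_ord1 !mul0r mulr0.
rewrite /binsum big_ord_recl mul0r mulr0 add0r mulr_sumr.
apply: eq_bigr => j _; rewrite lift0 !mulrA -!natrM.
by rewrite mulnC mul_bin_diag.
Qed.

Lemma binsum_mulr (k : nat) (phi : nat -> rat) :
  binsum k (fun j => (k - j)%:R * phi j) = k%:R * binsum k.-1 phi.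
Proof.
case: k => [|k]; first by rewrite /binsum big_ord1 !mul0r mulr0.
rewrite /binsum big_ord_recr /= subnn mul0r mulr0 addr0 mulr_sumr.
apply: eq_bigr => j _; rewrite !mulrA -!natrM; congr (_%:R * _).
by rewrite mulnC -mul_bin_down.
Qed.

Lemma sum_subsetU1 (T : finType) (x : T) (X : {set T}) (Phi : {set T} -> rat) :
  x \notin X ->
  \sum_(R : {set T} | R \subset x |: X) Phi R =
  \sum_(R : {set T} | R \subset X) Phi R +
  \sum_(R : {set T} | R \subset X) Phi (x |: R).
Proof.
move=> Xx; rewrite (bigID (fun R : {set T} => x \in R)) /= addrC; congr (_ + _).
  apply: eq_bigl => R; rewrite -[in RHS](setU1K Xx) subsetD1.
  by [].
rewrite (reindex_onto (fun R => x |: R) (fun R => R :\ x)) /=; last first.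
  by move=> R /andP[_ Rx]; rewrite setD1K.
apply: eq_bigl => R; rewrite setU11 andbT.
apply/andP/idP => [[sR /eqP RE]|sR].
  by rewrite -RE -(setU1K Xx) setSD.
by rewrite setUS // setU1K // (contra (subsetP sR x)).
Qed.

Lemma sum_subset_card (T : finType) (X : {set T}) (phi : nat -> rat) :
  \sum_(R : {set T} | R \subset X) phi #|R| = binsum #|X| phi.
Proof.
elim: {X}_.+1 {-2}X phi (ltnSn #|X|) => // m IHm X phi ltXm.
have [->|[x Xx]] := set_0Vmem X.
  rewrite (big_pred1 set0) => [|R]; last by rewrite subset0.
  by rewrite cards0 /binsum big_ord1 mul1r.
have cX := cardsD1 x X; rewrite Xx add1n in cX.
have xX : x \notin X :\ x by rewrite setD11.
have ltX : (#|X :\ x| < m)%N by rewrite -ltnS -cX.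
rewrite -{1}(setD1K Xx) sum_subsetU1 // cX binsumS -!IHm //.
congr (_ + _); apply: eq_bigr => R sR.
by rewrite cardsU1 (contra (subsetP sR x)).
Qed.

(** Multiplication of the generating function by exp t: He is an Appell
    sequence. *)
Lemma binsum_hermite (k : nat) (y : rat) :
  binsum k (fun j => hermite (k - j) y) = hermite k (y + 1).
Proof.
elim: k {-2}k (leqnn k) => [|m IHm] [|k] // lekm.
- by rewrite /binsum big_ord1 mulr1.
- by rewrite /binsum big_ord1 mulr1.
rewrite binsumS (eq_binsum (psi := fun j => y * hermite (k - j) y +
    -1 * ((k - j)%:R * hermite (k.-1 - j) y))) => [|j lejk].
  rewrite binsumD !binsumZ binsum_mulr hermiteS.
  have -> : binsum k (fun j => hermite (k.+1 - j.+1) y) = binsum k (fun j => hermite (k - j) y).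
    by apply: eq_binsum => j _; rewrite subSS.
  have [-> ->] : (binsum k (fun j => hermite (k - j) y) = hermite k (y + 1)) /\
    (binsum k.-1 (fun j => hermite (k.-1 - j) y) = hermite k.-1 (y + 1)).
    by split; apply: IHm; lia.
  by ring.
by rewrite subSn // hermiteS mulN1r; congr (_ - _ * hermite _ _); lia.
Qed.

(** * The closed forms and their recursion *)

(** This is k! times the coefficient of t^k in
    (1 - t) exp((k + w + 1) t - t^2/2). *)
Definition rooted_count (k w : nat) : rat :=
  hermite k (k + w + 1)%:R - k%:R * hermite k.-1 (k + w + 1)%:R.

(** This is k! times the coefficient of t^k in
    (1 + 2 w - t) exp((k + w + 3) t - t^2/2). *)
Definition rooted_edge_count (k w : nat) : rat :=
  (1 + 2 * w)%:R * hermite k (k + w + 3)%:R - k%:R * hermite k.-1 (k + w + 3)%:R.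

(** In generating functions the sum over j multiplies by exp t, which raises w by
    one: k - j and w + j have a constant sum, so all terms share their argument
    y. *)
Lemma rooted_count_peel (k w : nat) :
  binsum k (fun j => rooted_count (k - j) (w + j)) = rooted_count k w.+1.
Proof.
pose y : rat := (k + w + 1)%:R.
rewrite (eq_binsum (psi := fun j => hermite (k - j) y +
    -1 * ((k - j)%:R * hermite (k.-1 - j) y))) => [|j lejk].
  rewrite binsumD binsumZ binsum_mulr !binsum_hermite mulN1r /rooted_count.
  by have -> : (k + w.+1 + 1)%:R = y + 1 by rewrite /y natr1; congr _%:R; lia.
rewrite /rooted_count /y mulN1r.
have -> : (k - j + (w + j) + 1 = k + w + 1)%N by lia.
by have -> : (k.-1 - j = (k - j).-1)%N by lia.
Qed.

(** The second summand stands for the peelings that turn one of the two ends of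
    the prescribed edge into a root; contracting that edge makes the other end a
    root too. *)
Lemma rooted_edge_count_peel (k w : nat) :
  binsum k (fun j => rooted_edge_count (k - j) (w + j) +
                     2 * rooted_count (k - j) (w + j + 2))
  = rooted_edge_count k w.+1.
Proof.
pose y : rat := (k + w + 3)%:R.
rewrite (eq_binsum (psi := fun j => (3 + 2 * w)%:R * hermite (k - j) y +
    (2 * (j%:R * hermite (k - j) y) +
    -3 * ((k - j)%:R * hermite (k.-1 - j) y)))) => [|j lejk].
  rewrite !binsumD !binsumZ binsum_mulr binsum_mull.
  have -> : binsum k.-1 (fun j => hermite (k - j.+1) y) =
            binsum k.-1 (fun j => hermite (k.-1 - j) y).
    by apply: eq_binsum => j _; congr (hermite _ _); lia.
  rewrite !binsum_hermite /rooted_edge_count.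
  have -> : (k + w.+1 + 3)%:R = y + 1 by rewrite /y natr1; congr _%:R; lia.
  have -> : (1 + 2 * w.+1 = 3 + 2 * w)%N by lia.
  by ring.
rewrite /rooted_count /rooted_edge_count /y.
have -> : (k - j + (w + j) + 3 = k + w + 3)%N by lia.
have -> : (k - j + (w + j + 2) + 1 = k + w + 3)%N by lia.
have -> : (k.-1 - j = (k - j).-1)%N by lia.
by ring.
Qed.

(** Adding a root to an empty set of roots is no constraint; on the closed form
    this is the three-term recurrence, as k + 2 is the argument of both sides. *)
Lemma rooted_count0 (k : nat) : rooted_count k.+1 0 = rooted_count k 1.
Proof.
rewrite /rooted_count hermiteS /=.
have -> : (k.+1 + 0 + 1 = k + 1 + 1)%N by lia.
by ring.
Qed.

Lemma rooted_edge_count0 (k : nat) : rooted_edge_count k 0 = rooted_count k 2.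
Proof. by rewrite /rooted_edge_count /rooted_count addn0 muln0 mul1r -addnA. Qed.

(** * Bounds on ratios of Hermite polynomials *)

(** If He_k >= k He_(k-1), then He_(k+1) = y He_k - k He_(k-1) is at
    least (y - 1) He_k, and y - 1 >= k + 1 as long as k + 1 is in range. *)
Lemma hermite_ratio_ge (k : nat) (y : rat) : k.+1%:R <= y ->
  0 < hermite k y /\ k%:R * hermite k.-1 y <= hermite k y.
Proof.
elim: k => [|k IHk] ky; first by rewrite mul0r ler01.
have [] := IHk (le_trans _ ky); first by rewrite ler_nat.
rewrite hermiteS /= => hk hk1.
have ge_hk : k.+1%:R * hermite k y <= y * hermite k y - k%:R * hermite k.-1 y.
  have : 0 <= (y - k.+2%:R) * hermite k y by rewrite mulr_ge0 ?subr_ge0 // ltW.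
  rewrite -[k.+2]addn1 -[k.+1]addn1 !natrD; lra.
by split=> //; apply: lt_le_trans ge_hk; rewrite mulr_gt0 // ltr0n.
Qed.

Lemma rooted_count_ge0 (k w : nat) : 0 <= rooted_count k w.
Proof.
rewrite subr_ge0.
by case: (@hermite_ratio_ge k (k + w + 1)%:R); first by rewrite ler_nat; lia.
Qed.

(** One step of the continued fraction: He_(m+1)/He_m = y - m He_(m-1)/He_m, and
    He_m/He_(m-1) <= y. *)
Lemma hermite_ratio_le (m : nat) (y : rat) : m.+1%:R <= y ->
  y * hermite m.+1 y <= (y ^+ 2 - m%:R) * hermite m y.
Proof.
move=> my; rewrite hermiteS; case: m my => [|m] my /=; first by lra.
have [hm _] : 0 < hermite m.-1 y /\ m.-1%:R * hermite m.-2 y <= hermite m.-1 y.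
  by apply: hermite_ratio_ge; apply: le_trans my; rewrite ler_nat; lia.
have le1 : hermite m.+1 y <= y * hermite m y.
  by rewrite hermiteS gerBl mulr_ge0 ?ler0n // ltW.
have : 0 <= m.+1%:R * (y * hermite m y - hermite m.+1 y).
  by rewrite mulr_ge0 ?ler0n // subr_ge0.
nra.
Qed.

(** Here x = M - 2, y = x + 6, and a, b, c stand for He_M, He_(M-1), He_(M-2).  In
    terms of t = a - M b the claim is G b^2 - (x^2 - 2 x - 1) t b - x t^2 >= 0.
    The hypotheses give 0 <= t <= (K/D) b.  The quadratic form is concave in t,
    so it suffices that it is nonnegative at both ends of this range; for t = 0
    this is G >= 0.  Replacing one factor t of t^2 by its upper bound leaves
    b (D G b - (L - 36) t)/D, where L - 36 = x K + (x^2 - 2 x - 1) D.  Its constant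
    term - 36 is the only negative coefficient; once it is split off, both L and
    G D^2 - K L have nonnegative coefficients in x. *)
Lemma quadratic_bound (x a b c : rat) : 0 <= x -> 0 < b -> (x + 2) * b <= a ->
  (x + 6) * b <= ((x + 6) ^+ 2 - x) * c -> a = (x + 6) * b - (x + 1) * c ->
  (a - (x + 1) * b) * ((x + 9) * a - 2 * (x + 2) * b) <= (3 * a - (x + 2) * b) ^+ 2.
Proof.
move=> x0 b_gt0 ge_a le_b aE.
pose t := a - (x + 2) * b.
pose D := x ^+ 2 + 11 * x + 36.
pose K := 3 * x ^+ 2 + 37 * x + 138.
pose L := x * (x ^+ 3 + 12 * x ^+ 2 + 50 * x + 55).
pose G := 3 * x ^+ 2 + 7 * x + 2.
have t_ge0 : 0 <= t by rewrite subr_ge0.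
have D_gt0 : 0 < D by rewrite /D; nra.
have tD : 0 <= b * K - t * D.
  have : 0 <= (x + 1) * (((x + 6) ^+ 2 - x) * c - (x + 6) * b).
    by rewrite mulr_ge0 ?subr_ge0 // addr_ge0.
  by rewrite /t /D /K aE; nra.
have L_ge0 : 0 <= L.
  have [x2 x3] := (exprn_ge0 2 x0, exprn_ge0 3 x0).
  by rewrite mulr_ge0 //; lra.
have GLK : 0 <= G * D ^+ 2 - K * L.
  have -> : G * D ^+ 2 - K * L =
    3 * x ^+ 4 + 100 * x ^+ 3 + 883 * x ^+ 2 + 3066 * x + 2592.
    by rewrite /G /D /K /L; ring.
  by have [[x2 x3] x4] := (exprn_ge0 2 x0, exprn_ge0 3 x0, exprn_ge0 4 x0); lra.
rewrite -subr_ge0 -(pmulr_rge0 _ (exprn_gt0 2 D_gt0)).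
have -> : D ^+ 2 * ((3 * a - (x + 2) * b) ^+ 2 -
   (a - (x + 1) * b) * ((x + 9) * a - 2 * (x + 2) * b)) =
   D * x * t * (b * K - t * D) + b * L * (b * K - t * D) +
   b ^+ 2 * (G * D ^+ 2 - K * L) + 36 * D * t * b.
  by rewrite /t /D /K /L /G; ring.
have [Dge0 bge0] := (ltW D_gt0, ltW b_gt0).
have pos1 := mulr_ge0 (mulr_ge0 (mulr_ge0 Dge0 x0) t_ge0) tD.
have pos2 := mulr_ge0 (mulr_ge0 bge0 L_ge0) tD.
have pos3 := mulr_ge0 (exprn_ge0 2 bge0) GLK.
have pos4 := mulr_ge0 (mulr_ge0 (mulr_ge0 (ler0n _ 36) Dge0) t_ge0) bge0.
exact: addr_ge0 (addr_ge0 (addr_ge0 pos1 pos2) pos3) pos4.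
Qed.

Lemma hermite_quadratic_bound (M : nat) : (0 < M)%N ->
  let a := hermite M (M + 4)%:R in let b := hermite M.-1 (M + 4)%:R in
  (a - M.-1%:R * b) * ((M%:R + 7) * a - 2 * M%:R * b) <= (3 * a - M%:R * b) ^+ 2.
Proof.
(* For M = 1 the values are a = 5 and b = 1. *)
case: M => [|[|m]] // _.
cbv zeta; rewrite [m.+2.-1]/=; set y : rat := (m.+2 + 4)%:R.
have yE : y = m%:R + 6 by rewrite /y !addSn -addnS -addnS natrD.
have [_ ge_a] : 0 < hermite m.+2 y /\ m.+2%:R * hermite m.+1 y <= hermite m.+2 y.
  by apply: hermite_ratio_ge; rewrite ler_nat; lia.
have [b_gt0 _] : 0 < hermite m.+1 y /\ m.+1%:R * hermite m y <= hermite m.+1 y.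
  by apply: hermite_ratio_ge; rewrite ler_nat; lia.
have le_b : y * hermite m.+1 y <= (y ^+ 2 - m%:R) * hermite m y.
  by apply: hermite_ratio_le; rewrite ler_nat; lia.
have m2 : m.+2%:R = m%:R + 2 :> rat by rewrite -addn2 natrD.
have m1 : m.+1%:R = m%:R + 1 :> rat by rewrite natr1.
have -> : m.+2%:R + 7 = m%:R + 9 :> rat by rewrite m2; ring.
by rewrite m2 m1; apply: (quadratic_bound (c := hermite m y)); rewrite ?ler0n //
  -?yE -?m2 -?m1 //.
Qed.

(** * The inequality between the closed forms *)

Lemma rooted_count_disjoint (M : nat) : (0 < M)%N ->
  rooted_edge_count M.-1 2 * rooted_count (M + 3) 0 <= rooted_count (M + 1) 2 ^+ 2.
Proof.
move=> M0; rewrite addn3 rooted_count0.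
have := hermite_quadratic_bound M0.
rewrite (addn1 M) /rooted_edge_count /rooted_count /=.
have -> : (M.-1 + 2 + 3 = M + 4)%N by lia.
have -> : (M.+2 + 1 + 1 = M + 4)%N by lia.
have -> : (M.+1 + 2 + 1 = M + 4)%N by lia.
set y : rat := (M + 4)%:R; set a := hermite M y; set b := hermite M.-1 y.
have aE : a = y * b - M.-1%:R * hermite M.-2 y.
  by rewrite /a -{1}(prednK M0) hermiteS.
have yE : y = M%:R + 4 by rewrite /y natrD.
have M1 : M.-1%:R = M%:R - 1 :> rat by rewrite -[in RHS](prednK M0) -natr1 addrK.
have -> : M.+2%:R = M%:R + 2 :> rat by rewrite -addn2 natrD.
have -> : M.+1%:R = M%:R + 1 :> rat by rewrite natr1.
have -> : hermite M.+2 y = y * (y * a - M%:R * b) - (M%:R + 1) * a.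
  by rewrite !hermiteS /= natr1.
have -> : hermite M.+1 y = y * a - M%:R * b by rewrite hermiteS.
have -> : (1 + 2 * 2)%:R * b - M.-1%:R * hermite M.-2 y = a - M.-1%:R * b.
  by rewrite aE M1 yE; ring.
congr (_ * _ <= _ ^+ 2); rewrite yE; ring.
Qed.

Lemma rooted_count_adjacent (M : nat) :
  rooted_count M 3 * rooted_count (M + 3) 0 <= rooted_count (M + 1) 2 ^+ 2.
Proof.
have [->|M0] := posnP M; first by rewrite /rooted_count /hermite /= !natrD; nra.
apply: le_trans (rooted_count_disjoint M0).
rewrite ler_wpM2r ?rooted_count_ge0 // /rooted_count /rooted_edge_count.
have -> : (M.-1 + 2 + 3 = M + 3 + 1)%N by lia.
set y : rat := (M + 3 + 1)%:R.
have yE : y = M%:R + 4 by rewrite /y -addnA natrD.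
have -> : hermite M y = y * hermite M.-1 y - M.-1%:R * hermite M.-2 y.
  by rewrite -{1}(prednK M0) hermiteS.
have [b_gt0 _] : 0 < hermite M.-1 y /\ M.-1%:R * hermite M.-2 y <= hermite M.-1 y.
  by apply: hermite_ratio_ge; rewrite ler_nat; lia.
by rewrite -subr_ge0 (_ : _ - _ = hermite M.-1 y) ?ltW // yE; ring.
Qed.

(** * Evaluation of the forest counts *)

Lemma nforests_root (n : nat) (U : {set 'I_n}) (E : {set {set 'I_n}}) (x : 'I_n) :
  nforests U set0 E = nforests U [set x] E.
Proof.
apply: eq_card => F; rewrite !inE /separating_forest.
by rewrite !separated_le1 ?cards0 ?cards1.
Qed.

Lemma nforests_set0 (n : nat) : nforests (set0 : {set 'I_n}) set0 set0 = 1%N.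
Proof.
rewrite -(cards1 (set0 : {set {set 'I_n}})); apply: eq_card => F.
rewrite inE in_set1 sub0set /=.
have -> : edges_in (set0 : {set 'I_n}) = set0.
  by apply/setP => e; rewrite !inE subset0; have [->|_] := eqVneq e set0; rewrite ?cards0 ?andbF.
rewrite subset0; case: eqP => // -> /=; rewrite /separating_forest.
rewrite separated_le1 ?cards0 // andbT; apply/acyclicP => -[|x [|y c]] // _.
by rewrite /ucycle /= /adj inE.
Qed.

Lemma nforests_connected (n : nat) (U S : {set 'I_n}) (p q : 'I_n) :
  p != q -> p \in S -> q \in S -> nforests U S [set [set p; q]] = 0%N.
Proof.
move=> pq Sp Sq; apply: eq_card0 => F; rewrite inE; apply/negP.
rewrite sub1set => /and3P[_ Fpq /andP[_ /separatedP sepS]].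
by case/eqP: pq; apply: sepS => //; apply: connect1.
Qed.

Lemma cardsU_disjoint (n : nat) (R A : {set 'I_n}) :
  [disjoint R & A] -> #|R :|: A| = (#|A| + #|R|)%N.
Proof. by move=> dRA; rewrite cardsU (disjoint_setI0 dRA) cards0 subn0 addnC. Qed.

Lemma disjoint_peel (n : nat) (U S R : {set 'I_n}) (s : 'I_n) :
  R \subset U :\: S -> [disjoint R & S :\ s].
Proof.
move=> sR; rewrite disjoint_sym; apply: disjointWr sR _.
by rewrite -setI_eq0; apply/eqP/setP => x; rewrite !inE; case: (x \in S); rewrite ?andbF.
Qed.

Lemma nforests_rooted_count (n : nat) (U S : {set 'I_n}) : S \subset U ->
  (nforests U S set0)%:R = rooted_count #|U :\: S| #|S|.
Proof.
elim: {U}_.+1 {-2}U S (ltnSn #|U|) => // m IHm U S ltUm sSU.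
have {IHm} rooted (s : 'I_n) (S' : {set 'I_n}) : s \in S' -> S' \subset U ->
    (nforests U S' set0)%:R = rooted_count #|U :\: S'| #|S'|.
  move=> sS {}sSU; have Us := subsetP sSU s sS.
  rewrite (nforests_peel sS sSU (sub0set _)) natr_sum (cardsD1 s S') sS add1n.
  rewrite -rooted_count_peel -sum_subset_card; apply: eq_bigr => R sR.
  have ltU : (#|U :\ s| < m)%N by move: ltUm; rewrite (cardsD1 s U) Us.
  have sRSU : R :|: S' :\ s \subset U :\ s.
    rewrite subUset setSD // andbT; apply/subsetP => x /(subsetP sR).
    by rewrite !inE => /andP[nSx ->]; rewrite andbT; apply: contraNneq nSx => ->.
  rewrite IHm // cardsU_disjoint ?(disjoint_peel _ sR) //; congr (rooted_count _ _).
  have -> : (U :\ s) :\: (R :|: S' :\ s) = (U :\: S') :\: R.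
    apply/setP => x; rewrite !inE; case: eqP => [->|_]; first by rewrite sS !andbF.
    by rewrite negb_or; case: (x \in R).
  by rewrite cardsD (setIidPr sR).
have [S0|[s sS]] := set_0Vmem S; last exact: rooted sS sSU.
rewrite S0; have [->|[x Ux]] := set_0Vmem U.
  by rewrite nforests_set0 setD0 cards0 /rooted_count /hermite /= mul0r subr0.
rewrite (nforests_root _ _ x) (rooted x) ?set11 ?sub1set // cards1 setD0 cards0.
by rewrite (cardsD1 x U) Ux add1n rooted_count0.
Qed.

(** X is the set of vertices that are neither roots nor ends of the prescribed
    edge.  After peeling, the new roots R contain none, one or both of p and q:
    the first case is the induction hypothesis, contraction reduces the second
    to [nforests_rooted_count], and the third contributes nothing. *)
Lemma nforests_rooted_edge_count (n : nat) (U S X : {set 'I_n}) (p q : 'I_n) :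
  S \subset U -> U :\: S = p |: (q |: X) -> p != q -> p \notin X -> q \notin X ->
  (nforests U S [set [set p; q]])%:R = rooted_edge_count #|X| #|S|.
Proof.
move=> + + pq Xp Xq; elim: {U}_.+1 {-2}U S X Xp Xq (ltnSn #|U|) => // m IHm.
move=> U S X Xp Xq ltUm sSU UE.
have [Up Sp] : p \in U /\ p \notin S.
  by apply/andP; rewrite andbC -in_setD UE !inE eqxx.
have [Uq Sq] : q \in U /\ q \notin S.
  by apply/andP; rewrite andbC -in_setD UE !inE eqxx orbT.
have [S0|[s sS]] := set_0Vmem S.
  rewrite S0 (nforests_root _ _ p) -[[set [set p; q]]]setU0.
  rewrite nforests_contract ?sub1set ?set11 ?inE // 1?eq_sym //.
  rewrite nforests_rooted_count ?subUset ?sub1set ?Up ?Uq // cards0 rooted_edge_count0.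
  rewrite cards2 eq_sym pq; congr (rooted_count _ _).
  have -> // : U :\: [set q; p] = X.
  rewrite setUC -setDDl -[U]setD0 -S0 UE setU1K ?setU1K // !inE negb_or pq.
  by [].
have Us := subsetP sSU s sS.
have [sp sq] : s != p /\ s != q by split; [apply: contraNneq Sp | apply: contraNneq Sq] => <-.
have ltU : (#|U :\ s| < m)%N.
  by move: ltUm; rewrite (cardsD1 s U) Us.
have pqE : [set [set p; q]] \subset edges_in (U :\ s).
  by rewrite sub1set set2_edges_in pq !inE Up Uq !(eq_sym _ s) sp sq.
rewrite (nforests_peel sS sSU pqE).
rewrite natr_sum UE !sum_subsetU1 ?inE ?negb_or ?pq //.
rewrite (cardsD1 s S) sS add1n -rooted_edge_count_peel -!sum_subset_card -!big_split.
apply: eq_bigr => R sR /=.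
have RX x : x \in R -> x \in X by move/(subsetP sR).
have sRUS : R \subset U :\: S by rewrite UE !(subset_trans sR) // !subsetU ?subxx ?orbT.
set A := R :|: S :\ s; rewrite -!setUA -/A.
have cA : #|A| = (#|S :\ s| + #|R|)%N by rewrite cardsU_disjoint ?(disjoint_peel _ sRUS).
have Ap : p \notin A by rewrite !inE (negPf Sp) andbF orbF; apply: contra Xp => /RX.
have Aq : q \notin A by rewrite !inE (negPf Sq) andbF orbF; apply: contra Xq => /RX.
have sAU : A \subset U :\ s.
  rewrite subUset setSD // andbT; apply/subsetP => x /(subsetP sRUS).
  by rewrite !inE => /andP[nSx ->]; rewrite andbT; apply: contraNneq nSx => ->.
have cX : #|X :\: R| = (#|X| - #|R|)%N by rewrite cardsD (setIidPr sR).
have UA : (U :\ s) :\: A = p |: (q |: (X :\: R)).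
  have -> : (U :\ s) :\: A = (U :\: S) :\: R.
    apply/setP => x; rewrite !inE; case: eqP => [->|_]; first by rewrite sS !andbF.
    by rewrite negb_or; case: (x \in R).
  have RD x : x \notin X -> [set x] :\: R = [set x].
    by move=> Xx; apply/setDidPl; rewrite disjoints1; apply: contra Xx => /RX.
  by rewrite UE !setDUl !RD.
have sUs x : x \in U -> x \notin S -> x \in U :\ s.
  by move=> Ux Sx; rewrite !inE Ux andbT; apply: contraNneq Sx => ->.
have both : (nforests (U :\ s) (p |: (q |: A)) set0)%:R =
            rooted_count (#|X| - #|R|) (#|S :\ s| + #|R| + 2).
  rewrite nforests_rooted_count; last first.
    by rewrite 2!subUset 2!sub1set !sUs.
  rewrite !cardsU1 in_setU1 (negPf pq) (negPf Ap) (negPf Aq) cA.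
  have -> : (U :\ s) :\: (p |: (q |: A)) = X :\: R.
    rewrite setUA setUC -setDDl UA; apply/setP => x; rewrite !inE.
    have [->|_] := eqVneq x p; first by rewrite (negPf Xp) andbF.
    by have [->|_] := eqVneq x q; rewrite ?(negPf Xq) ?andbF.
  by rewrite cX /= !add1n addn2.
have mixed x y : [set x; y] = [set p; q] -> x != y -> x \notin A -> y \notin A ->
    x \in U :\ s -> y \in U :\ s ->
    (nforests (U :\ s) (x |: A) [set [set p; q]])%:R =
    rooted_count (#|X| - #|R|) (#|S :\ s| + #|R| + 2).
  move=> xyE xy Ax Ay Ux Uy; rewrite -xyE -[[set [set x; y]]]setU0.
  have sxA : x |: A \subset U :\ s by rewrite subUset sub1set Ux.
  have yxA : y \notin x |: A by rewrite in_setU1 negb_or eq_sym xy.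
  rewrite nforests_contract ?setU11 ?in_set0 // -both.
  by congr (nforests _ _ _)%:R; rewrite !setUA -xyE [[set y] :|: _]setUC.
have [XRp XRq] : p \notin X :\: R /\ q \notin X :\: R.
  by rewrite !in_setD (negPf Xp) (negPf Xq) !andbF.
rewrite (IHm _ _ _ XRp XRq ltU sAU UA) cA cX.
rewrite (mixed p q) ?sUs // (mixed q p) ?sUs // 1?eq_sym //; last by rewrite setUC.
rewrite (nforests_connected _ pq) ?setU11 ?in_setU1 ?eqxx ?orbT //.
by ring.
Qed.

(** * Negative correlation of edges *)

Lemma card_forests_containing (n : nat) (E : {set {set 'I_n}}) :
  #|[set F in forests n | E \subset F]| = nforests [set: 'I_n] set0 E.
Proof.
apply: eq_card => F; rewrite !inE /separating_forest separated_le1 ?cards0 // andbT.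
rewrite -andbA [acyclic F && _]andbC.
by have -> : edges_in [set: 'I_n] = complete_edges n by apply/setP => e; rewrite !inE subsetT andbT.
Qed.

Lemma nforests_edge (n : nat) (a b : 'I_n) (E : {set {set 'I_n}}) :
  a != b -> [set a; b] \notin E ->
  nforests [set: 'I_n] set0 ([set a; b] |: E) = nforests [set: 'I_n] [set a; b] E.
Proof.
move=> ab nE; rewrite (nforests_root _ _ a) nforests_contract ?subsetT ?inE //.
  by rewrite setUC.
by rewrite eq_sym.
Qed.

(** After the contraction of e, the edge f either touches the roots, which a
    second contraction handles, or is disjoint from them. *)
Lemma nforests_two_edges (M : nat) (e f : {set 'I_(M + 3)}) :
  e \in complete_edges (M + 3) -> f \in complete_edges (M + 3) -> e != f ->
  (nforests [set: 'I_(M + 3)] set0 [set e; f])%:R * rooted_count (M + 3) 0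
    <= rooted_count (M + 1) 2 ^+ 2.
Proof.
rewrite !inE => /cards2P[a [b [ab ->]]] /cards2P[p [q [pq ->]]].
set e' := [set a; b] => ef.
have ce : #|e'| = 2%N by rewrite cards2 ab.
have compl_e (T : {set 'I_(M + 3)}) : #|[set: 'I_(M + 3)] :\: T| = (M + 3 - #|T|)%N.
  by rewrite setTD cardsCs setCK card_ord.
rewrite nforests_edge ?in_set1 // -/e'.
have touching x y : x \in e' -> y \notin e' -> [set x; y] = [set p; q] ->
    (nforests [set: 'I_(M + 3)] e' [set [set p; q]])%:R = rooted_count M 3.
  move=> ex ey <-; rewrite -[[set [set x; y]]]setU0 nforests_contract ?subsetT ?in_setT ?in_set0 //.
  by rewrite nforests_rooted_count ?subsetT // compl_e cardsU1 ey ce /= addnK.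
have [ep|ep] := boolP (p \in e'); have [eq|eq] := boolP (q \in e').
- case/negP: ef; rewrite eq_sym eqEcard subUset !sub1set ep eq /=.
  by rewrite ce cards2 pq.
- by rewrite (touching p q) // rooted_count_adjacent.
- by rewrite (touching q p) // 1?setUC // rooted_count_adjacent.
pose X := ([set: 'I_(M + 3)] :\: e') :\ p :\ q.
have UE : [set: 'I_(M + 3)] :\: e' = p |: (q |: X).
  apply/setP => x; rewrite !in_setU1 !in_setD1.
  have [->|_] := eqVneq x p; first by rewrite in_setD ep in_setT.
  by have [->|_] := eqVneq x q; rewrite ?in_setD ?eq ?in_setT.
have Xp : p \notin X by rewrite !inE eqxx andbF.
have Xq : q \notin X by rewrite !inE eqxx.
rewrite (nforests_rooted_edge_count (subsetT _) UE pq Xp Xq) ce.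
have cX : M = #|X|.+1.
  have := congr1 (fun A : {set 'I_(M + 3)} => #|A|) UE.
  rewrite compl_e ce !cardsU1 Xq in_setU1 (negPf pq) (negPf Xp) /=.
  by rewrite -addnBA // addn1 !add1n => -[].
rewrite (congr1 predn (esym cX) : #|X| = M.-1).
by apply: rooted_count_disjoint; rewrite [X in (_ < X)%N]cX.
Qed.

Theorem theorem1p2 (n : nat) (hn : (2 <= n)%N) (e f : {set 'I_n})
  (he : e \in complete_edges n) (hf : f \in complete_edges n) (hef : e <> f) :
  forest_prob (fun F : {set {set 'I_n}} => (e \in F) && (f \in F))
  <= forest_prob (fun F : {set {set 'I_n}} => e \in F)
     * forest_prob (fun F : {set {set 'I_n}} => f \in F).
Proof.
have /eqP ef := hef.
(* Two distinct edges span at least three vertices. *)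
have n3 : (3 <= n)%N.
  have := max_card (e :|: f); rewrite card_ord; apply: leq_trans.
  move: he hf; rewrite !inE => /eqP ce /eqP cf; rewrite -ce proper_card //.
  rewrite properE subsetUl subUset subxx /=; apply: contra ef => fe.
  by rewrite eq_sym eqEcard fe ce cf.
have nE : n = (n - 3 + 3)%N by rewrite subnK.
move: (n - 3)%N nE => M nE; subst n; clear hn n3.
have one g : g \in complete_edges (M + 3) ->
    #|[set F in forests (M + 3) | g \in F]|%:R = rooted_count (M + 1) 2.
  rewrite inE => /cards2P[a [b [ab ->]]].
  have -> : #|[set F in forests (M + 3) | [set a; b] \in F]| =
            #|[set F in forests (M + 3) | [set [set a; b]] \subset F]|.
    by apply: eq_card => F; rewrite [LHS]inE [RHS]inE sub1set.
  rewrite card_forests_containing -[[set [set a; b]]]setU0 nforests_edge ?in_set0 //.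
  rewrite nforests_rooted_count ?subsetT // setTD cardsCs setCK card_ord cards2 ab.
  by congr (rooted_count _ _); lia.
have total : #|forests (M + 3)|%:R = rooted_count (M + 3) 0.
  have -> : #|forests (M + 3)| = #|[set F in forests (M + 3) | set0 \subset F]|.
    by apply: eq_card => F; rewrite [RHS]inE sub0set andbT.
  by rewrite card_forests_containing nforests_rooted_count ?subsetT // setD0 cardsT card_ord cards0.
rewrite /forest_prob !one // total.
have -> : #|[set F in forests (M + 3) | (e \in F) && (f \in F)]| =
          #|[set F in forests (M + 3) | [set e; f] \subset F]|.
  by apply: eq_card => F; rewrite [LHS]inE [RHS]inE subUset !sub1set.
rewrite card_forests_containing.
have := nforests_two_edges he hf ef; have := rooted_count_ge0 (M + 3) 0.
rewrite le0r => /predU1P[->|z_gt0 le2]; first by rewrite invr0 !mulr0.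
rewrite mulrACA ler_pdivrMr // -!mulrA mulVf ?gt_eqF // mulr1.
by rewrite mulrA -expr2 ler_pdivlMr.
Qed.
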